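(* Let $n\ge 1$ and $k\ge 1$ be integers. In the hat game with $n$ prisoners and $k$ extra hats (described in the context), a perfect deterministic strategy exists if and only if $\alpha_{n,k}=\frac{(n+k)!}{(k+1)!}$, i.e. if and only if the arrangement graph $A_{n+k,n}$ has an independent set whose size is $\frac{1}{k+1}$ of its number of vertices $\frac{(n+k)!}{k!}$.
   Context: Hat game with $n$ prisoners and $k$ extra hats: prisoners numbered $1,\dots,n$ stand in a line; there are $n+k$ hats with distinct colors $1,2,\dots,n+k$. The warden assigns to the prisoners a uniformly random injective map $\{1,\dots,n\}\to\{1,\dots,n+k\}$ (prisoner $i$ gets color $x_i$; the $k$ remaining hats are discarded), so the hat assignment is a uniformly random ordered $n$-tuple $(x_1,\dots,x_n)$ of distinct elements of $\{1,\dots,n+k\}$. Prisoner $i$ sees exactly the colors $x_{i+1},\dots,x_n$. The prisoners guess their own colors in the order $1,2,\dots,n$, each hearing all earlier guesses. A deterministic strategy specifies, for each $i$, prisoner $i$'s guess as a function of $(x_{i+1},\dots,x_n)$ and the earlier guesses; it is agreed upon before the hats are placed. The prisoners win if every guess is correct. The success probability of a strategy is the fraction of the $(n+k)!/k!$ possible assignments on which they win. A strategy is perfect if its success probability equals $1/(k+1)$. The arrangement graph $A_{n+k,n}$ has as vertices all ordered $n$-tuples of distinct integers from $\{1,\dots,n+k\}$, two vertices being adjacent iff the tuples differ in exactly one coordinate; $\alpha_{n,k}$ denotes its independence number. *)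

(* Defs.v *)
From HB Require Import structures.
From mathcomp Require Import all_boot all_order all_algebra.

Set Implicit Arguments.
Unset Strict Implicit.
Unset Printing Implicit Defensive.

Import Order.TTheory GRing.Theory Num.Theory.

(* Prisoners and colours are numbered from 0: prisoner i : 'I_n is the usual
   prisoner i + 1, and colour c : 'I_(n + k) is the usual colour c + 1. *)
Definition colour (n k : nat) : Type := 'I_(n + k).

HB.instance Definition _ (n k : nat) := Finite.on (colour n k).

Definition assignment (n k : nat) : Type := {x : n.-tuple (colour n k) | uniq x}.

HB.instance Definition _ (n k : nat) := Finite.on (assignment n k).
HB.instance Definition _ (n k : nat) := SubType.on (assignment n k).

(* [s i heard seen] is the guess of prisoner i after hearing the earlier guesses
   [heard] (in order) and seeing the colours [seen] of the prisoners in front.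
   In actual play [heard] has size i and [seen] has size n - i - 1; values of
   [s] at sequences of other sizes are never consulted. *)
Definition strategy (n k : nat) : Type :=
  'I_n -> seq (colour n k) -> seq (colour n k) -> colour n k.

Definition seen (n k : nat) (x : assignment n k) (i : 'I_n) :
    seq (colour n k) :=
  drop i.+1 (val x).

(* [enum 'I_n] lists the prisoners in increasing order, so the accumulator is
   the list of guesses made before prisoner i speaks. *)
Definition guesses (n k : nat) (s : strategy n k) (x : assignment n k) :
    seq (colour n k) :=
  foldl (fun heard i => rcons heard (s i heard (seen x i))) [::] (enum 'I_n).

Definition wins (n k : nat) (s : strategy n k) (x : assignment n k) : bool :=
  guesses s x == val x :> seq (colour n k).

Definition success_prob (n k : nat) (s : strategy n k) : rat :=
  (#|[set x : assignment n k | wins s x]|%:R / #|{: assignment n k}|%:R)%R.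

Definition perfect (n k : nat) (s : strategy n k) : Prop :=
  success_prob s = (1 / k.+1%:R)%R.

(* The adjacency relation of the arrangement graph A_{n+k,n}, whose vertices
   are the hat assignments. *)
Definition arrangement (n k : nat) : rel (assignment n k) :=
  fun x y => #|[set i : 'I_n | tnth (val x) i != tnth (val y) i]| == 1.

Definition independent (T : finType) (e : rel T) (A : {set T}) : bool :=
  [forall x in A, forall y in A, ~~ e x y].

Definition independence_number (T : finType) (e : rel T) : nat :=
  \max_(A : {set T} | independent e A) #|A|.

Definition alpha (n k : nat) : nat := independence_number (@arrangement n k).

Lemma card_assignment (n k : nat) :
  (#|{: assignment n k}|%:R = (n + k)`!%:R / k`!%:R :> rat)%R.
Proof.
have -> : #|{: assignment n k}| = (n + k) ^_ n.
  rewrite card_sig -[X in X ^_ _](card_ord (n + k)).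
  rewrite -(card_uniq_tuples n (pred_of_simpl (@predT (colour n k)))) cardsE.
  by apply: eq_card => x; rewrite !inE [RHS]unfold_in /= all_predT.
have := ffact_fact (leq_addr k n); rewrite addKn => <-.
by rewrite natrM mulfK // pnatr_eq0 -lt0n fact_gt0.
Qed.

(* Main.v *)
(* Both sides compute the same maximum. Two winning assignments cannot differ in
   a single coordinate i, since prisoner i would have the same information in
   both, so the winning set of a strategy is independent. Conversely, given an
   independent set, each prisoner who has heard only correct guesses announces
   the unique colour, if any, that completes what he hears and sees to a member
   of the set; this wins on the whole set. Finally, deleting the first coordinate
   is injective on an independent set, which bounds its size by the number
   (n + k)! / (k + 1)! of injective (n - 1)-tuples. *)
Require Import Defs.
From mathcomp Require Import all_boot all_order all_algebra.

Set Implicit Arguments.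
Unset Strict Implicit.
Unset Printing Implicit Defensive.

Import Order.TTheory GRing.Theory Num.Theory.

Section FoldlRcons.

Variables (T U : Type) (f : seq T -> U -> T).

Let build := foldl (fun h a => rcons h (f h a)) [::].

Lemma size_foldl_rcons l : size (build l) = size l.
Proof.
by elim/last_ind: l => //= l a IHl; rewrite /build foldl_rcons !size_rcons IHl.
Qed.

(** Appending never changes earlier entries, so the accumulator present at step [j] survives as the
    length-[j] prefix of the final list. *)
Lemma nth_foldl_rcons d e l j :
  j < size l -> nth d (build l) j = f (take j (build l)) (nth e l j).
Proof.
elim/last_ind: l => //= l a IHl; rewrite /build foldl_rcons -/build.
rewrite size_rcons ltnS => le_jl.
rewrite !nth_rcons -cats1 take_cat size_foldl_rcons.
case: ltngtP le_jl => // [lt_jl _ | -> _]; first exact: IHl.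
by rewrite subnn take0 cats0.
Qed.

End FoldlRcons.

Section HatGame.

Variables n k : nat.
Implicit Types (s : strategy n k) (x y : assignment n k) (i j : 'I_n).
Implicit Types A : {set assignment n k}.

Lemma assignment_eqP x y :
  (forall j, tnth (val x) j = tnth (val y) j) -> x = y.
Proof. by move=> exy; apply/val_inj/eq_from_tnth. Qed.

(** Assignments that agree off [i] are equal or adjacent, so in an independent set the coordinates
    other than [i] determine the member. *)
Lemma independentP A :
  reflect {in A &, forall x y i,
             (forall j, j != i -> tnth (val x) j = tnth (val y) j) -> x = y}
          (independent (@arrangement n k) A).
Proof.
apply: (iffP idP) => [indA x y Ax Ay i exy | injA].
  have := forall_inP (forall_inP indA x Ax) y Ay; apply: contraNeq => neq_xy.
  suff -> : arrangement x y = (#|[set i]| == 1) by rewrite cards1.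
  congr (#|pred_of_set _| == 1); apply/setP=> j; rewrite !inE.
  have [-> | /exy->] := eqVneq j i; last by rewrite eqxx.
  apply: contra_neqT neq_xy => /negbNE/eqP exyi.
  by apply: assignment_eqP => l; have [-> | /exy] := eqVneq l i.
apply/forall_inP=> x Ax; apply/forall_inP=> y Ay.
apply/negP=> /cards1P[i Di]; have exy : x = y.
  apply: (injA x y Ax Ay i) => j; rewrite -(in_set1 j) -Di inE negbK.
  by move/eqP.
by move/setP/(_ i): Di; rewrite exy !inE !eqxx.
Qed.

(** As long as all guesses so far are correct, the next prisoner hears true colours; the recursion
    through [guesses] thus splits into one condition per prisoner. *)
Lemma winsP s x :
  reflect (forall i, s i (take i (val x)) (seen x i) = tnth (val x) i)
          (wins s x).
Proof.
have size_x : size (val x) = n by rewrite size_tuple.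
have nth_guesses i d :
  nth d (guesses s x) i = s i (take i (guesses s x)) (seen x i).
  by rewrite (nth_foldl_rcons _ d i) ?size_enum_ord // nth_ord_enum.
have size_guesses : size (guesses s x) = n.
  by rewrite size_foldl_rcons size_enum_ord.
apply: (iffP eqP) => [win i | good].
  by rewrite (tnth_nth (tnth (val x) i)) -[in RHS]win nth_guesses win.
suff: forall m, m <= n -> take m (guesses s x) = take m (val x).
  by move/(_ n (leqnn n)); rewrite !take_oversize ?size_guesses ?size_x.
elim=> [|m IHm] lt_mn; first by rewrite !take0.
pose i := Ordinal lt_mn; set d := tnth (val x) i.
rewrite !(take_nth d) ?size_guesses ?size_x // IHm ?(ltnW lt_mn) //.
by rewrite (nth_guesses i) IHm ?(ltnW lt_mn) // good (tnth_nth d).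
Qed.

Lemma independent_wins s : independent (@arrangement n k) [set x | wins s x].
Proof.
apply/independentP=> x y; rewrite !inE => /winsP win_x /winsP win_y i exy.
have nth_xy d (m : nat) : m != i :> nat -> nth d (val x) m = nth d (val y) m.
  have [lt_mn neq_mi | le_nm _] := ltnP m n; last first.
    by rewrite !nth_default ?size_tuple.
  by have := exy (Ordinal lt_mn) neq_mi; rewrite !(tnth_nth d).
apply: assignment_eqP => j; have [-> | /exy//] := eqVneq j i.
have d := tnth (val x) i.
rewrite -win_x -win_y /seen; congr s; apply: (@eq_from_nth _ d).
- by rewrite !size_take !size_tuple.
- move=> m; rewrite size_take size_tuple ltn_ord => lt_mi.
  by rewrite !nth_take // nth_xy // ltn_eqF.
- by rewrite !size_drop !size_tuple.
- move=> m _; rewrite !nth_drop nth_xy // gtn_eqF //.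
  by rewrite addSn ltnS leq_addr.
Qed.

Lemma independent_sub_wins A :
  independent (@arrangement n k) A ->
  exists s, A \subset [set x | wins s x].
Proof.
move/independentP=> indA.
pose fits h t (c : colour n k) :=
  [exists y in A, val (val y) == h ++ c :: t].
(* [lshift k i] is an arbitrary colour for the case where none fits. *)
exists (fun i h t => odflt (lshift k i) [pick c | fits h t c]).
apply/subsetP=> x Ax; rewrite inE; apply/winsP=> i; set d := tnth (val x) i.
have x_eq : val (val x) = take i (val x) ++ d :: seen x i.
  rewrite -[LHS](cat_take_drop i) (drop_nth d) ?size_tuple //.
  by rewrite {2}/d (tnth_nth d).
(* The pick cannot fail, since [x] itself witnesses [d]. If it returns [c], the witness [y] agrees
   with [x] off [i], so independence forces [c = d]. *)
case: pickP => [c /exists_inP[y Ay /eqP y_eq] | /(_ d)/exists_inP[]]; last first.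
  by exists x => //; apply/eqP.
have size_take_x : size (take i (val x)) = i.
  by rewrite size_take size_tuple ltn_ord.
suff exy : x = y.
  by rewrite /= /d exy (tnth_nth c) y_eq nth_cat size_take_x ltnn subnn.
apply: (indA x y Ax Ay i) => j neq_ji.
rewrite !(tnth_nth d) x_eq y_eq !nth_cat size_take_x.
have [// | le_ij] := ltnP j i.
have lt_ij : i < j by rewrite ltn_neqAle eq_sym neq_ji.
(* Writing [j - i] as a successor makes [nth] skip the heads [d] and [c], leaving the common tail
   [seen x i]. *)
by rewrite -(subnSK lt_ij).
Qed.

End HatGame.

Lemma leq_card_independent (n k : nat) (A : {set assignment n k}) :
  0 < n -> independent (@arrangement n k) A -> #|A| <= (n + k) ^_ n.-1.
Proof.
case: n A => // n A _ /independentP indA /=.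
rewrite -[X in X ^_ _](card_ord (n.+1 + k)).
rewrite -(card_uniq_tuples n (pred_of_simpl (@predT (colour n.+1 k)))).
pose f (x : assignment n.+1 k) := [tuple of behead (val x)].
have injf : {in A &, injective f}.
  move=> x y Ax Ay exy; apply: (indA x y Ax Ay ord0) => j.
  have [j' -> _|->] := unliftP ord0 j; last by rewrite eqxx.
  have := congr1 (fun t => tnth t j') exy; rewrite !tnth_behead.
  suff -> : inord j'.+1 = lift ord0 j' by [].
  by apply/val_inj; rewrite /= inordK ?ltnS.
rewrite -(card_in_imset injf) subset_leq_card //.
apply/subsetP=> _ /imsetP[x _ ->]; rewrite !inE all_predT /=.
by case: x => x /=; case/tupleP: x => a t /= /andP[].
Qed.

Lemma ffact_predE (n k : nat) :
  0 < n -> (((n + k) ^_ n.-1)%:R = (n + k)`!%:R / (k.+1)`!%:R :> rat)%R.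
Proof.
case: n => // n _ /=.
(* Regrouping [n.+1 + k] as [n + k.+1] shows that [n] falling factors leave the factorial of
   [k.+1]. *)
have := ffact_fact (leq_addr k.+1 n); rewrite addKn addnS -addSn => <-.
by rewrite natrM mulfK // pnatr_eq0 -lt0n fact_gt0.
Qed.

Lemma max_fractionE (n k : nat) :
  (1 / k.+1%:R * #|{: assignment n k}|%:R =
     (n + k)`!%:R / (k.+1)`!%:R :> rat)%R.
Proof. by rewrite card_assignment factS natrM invfM mul1r mulrCA. Qed.

(** Clearing the denominator turns perfection into a count in [nat], where cardinality bounds
    apply. *)
Lemma perfectE (n k : nat) (s : strategy n k) :
  0 < n -> perfect s <-> #|[set x | wins s x]| = (n + k) ^_ n.-1.
Proof.
move=> n_gt0; rewrite /perfect /success_prob.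
have V_neq0 : (#|{: assignment n k}|%:R != 0 :> rat)%R.
  by rewrite card_assignment mulf_neq0 ?invr_eq0 // pnatr_eq0 -lt0n fact_gt0.
split=> [perf | ->]; last first.
  by rewrite ffact_predE // -max_fractionE mulfK.
apply/eqP; rewrite -(eqr_nat rat) ffact_predE // -max_fractionE -perf.
by rewrite divfK.
Qed.

Lemma perfect_independentP (n k : nat) :
  0 < n ->
  (exists s : strategy n k, perfect s) <->
  (exists A : {set assignment n k},
     independent (@arrangement n k) A /\ #|A| = (n + k) ^_ n.-1).
Proof.
move=> n_gt0; split=> [[s /(perfectE s n_gt0) perf] | [A [indA cardA]]].
  by exists [set x | wins s x]; split=> //; apply: independent_wins.
have [s sAW] := independent_sub_wins indA; exists s; apply/perfectE => //.
(* The winning set contains [A] and is itself independent, so it is squeezed between [#|A|] and the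
   upper bound. *)
apply/eqP; rewrite eqn_leq leq_card_independent ?independent_wins //.
by rewrite -cardA subset_leq_card.
Qed.

Lemma alpha_maxP (n k : nat) :
  0 < n ->
  alpha n k = (n + k) ^_ n.-1 <->
  (exists A : {set assignment n k},
     independent (@arrangement n k) A /\ #|A| = (n + k) ^_ n.-1).
Proof.
move=> n_gt0; split=> [alphaE | [A [indA cardA]]].
  (* The empty set makes the family of independent sets nonempty, so the maximum is attained. *)
  have ind0 : independent (@arrangement n k) set0.
    by apply/forall_inP=> x; rewrite inE.
  have ind_gt0 : 0 < #|independent (@arrangement n k)|.
    by apply/card_gt0P; exists set0.
  have [A indA alphaA] :=
    eq_bigmax_cond (fun A : {set assignment n k} => #|A|) ind_gt0.
  by exists A; split; [exact: indA | exact: etrans (esym alphaA) alphaE].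
apply/eqP; rewrite eqn_leq; apply/andP; split.
  by apply/bigmax_leqP=> B; apply: leq_card_independent.
by rewrite -cardA; apply: leq_bigmax_cond.
Qed.

Theorem theorem1 (n k : nat) (hn : 1 <= n) (hk : 1 <= k) :
  ((exists s : strategy n k, perfect s) <->
     ((alpha n k)%:R = (n + k)`!%:R / (k.+1)`!%:R :> rat)%R)
  /\
  ((exists s : strategy n k, perfect s) <->
     (exists A : {set assignment n k},
        independent (@arrangement n k) A /\
        (#|A|%:R = 1 / k.+1%:R * #|{: assignment n k}|%:R :> rat)%R)).
Proof.
have natE m : (m%:R = (n + k)`!%:R / (k.+1)`!%:R :> rat)%R <->
              m = (n + k) ^_ n.-1.
  by rewrite -ffact_predE //; split=> [/eqP | -> //]; rewrite eqr_nat => /eqP.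
have perfP := perfect_independentP k hn; split.
  exact: iff_trans perfP (iff_sym (iff_trans (natE _) (alpha_maxP k hn))).
rewrite max_fractionE; apply: (iff_trans perfP).
by split=> -[A [indA cardA]]; exists A; split=> //; apply/natE.
Qed.
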